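(* Every invitation-depressed monotone (ID-MON) allocation rule $f$ is network-implementable.
   Context: Network auction model. There is a finite set $N$ of bidders and a seller. Bidder $i$ has true type $\theta_i=(v_i,r_i)$, where $v_i\in\mathbb R_{\ge0}$ is her value for winning and $r_i$ is her set of neighbors in the social network (those she can invite). She reports $\theta_i'=(v_i',r_i')\in\Theta_i=\mathbb R_{\ge 0}\times\mathcal P(r_i)$, where $\mathcal P(r_i)$ is the power set of $r_i$; $\Theta=\times_{i\in N}\Theta_i$. A mechanism is $\mathcal M=(f,p)$ with allocation rule $f=(f_i)_{i\in N}$, $f_i:\Theta\to\{0,1\}$, and payment rule $p=(p_i)_{i\in N}$, $p_i:\Theta\to\mathbb R$; the utility of $i$ is $u_i(\theta')=f_i(\theta')v_i-p_i(\theta')$. $\mathcal M$ is strategyproof if for all $\theta'\in\Theta$ and all $i\in N$, $u_i((v_i,r_i),\theta'_{-i})\ge u_i((v_i',r_i'),\theta'_{-i})$, i.e. truthfully reporting the value and inviting all neighbors is a dominant strategy. An allocation rule $f$ is network-implementable if there exists a payment rule $p$ such that $(f,p)$ is strategyproof. Invitation-depressed partial order: $(v_i^1,r_i^1)\succeq_{\mathcal D}(v_i^2,r_i^2)$ if $v_i^1\ge v_i^2$ and $r_i^1\subseteq r_i^2$. $f$ is ID-MON if for every bidder $i$ and every profile $\theta_{-i}$ of the others, $f_i(\theta_i,\theta_{-i})=1$ implies $f_i(\theta_i',\theta_{-i})=1$ for all $\theta_i'\succeq_{\mathcal D}\theta_i$.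
   Formalization: Added hypothesis: whenever bidder i wins with some report against the others' reports, she also wins at some value when inviting all of r_i. Without it the claim fails (e.g. i wins iff she invites nobody, r_i nonempty); for ID-MON rules the condition is also necessary. *)

(* Defs.v *)
From mathcomp Require Import all_boot all_order all_algebra.
From mathcomp Require Import reals.

Set Implicit Arguments.
Unset Strict Implicit.
Unset Printing Implicit Defensive.

Import Order.TTheory GRing.Theory Num.Theory.
Local Open Scope ring_scope.

Section NetworkAuction.
Variables (R : realType) (N : finType) (r : N -> {set N}).

(* R_{>=0} * P(r i) *)
Definition type_space (i : N) : Type :=
  {t : R * {set N} | (0 <= t.1) && (t.2 \subset r i)}.

Definition value (i : N) (t : type_space i) : R := (val t).1.

Definition invited (i : N) (t : type_space i) : {set N} := (val t).2.

Definition profile : Type := forall i : N, type_space i.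

(* The profile (t, theta_{-i}); the entry theta i is ignored. *)
Definition deviate (theta : profile) (i : N) (t : type_space i) : profile :=
  dfwith theta t.

Definition allocation_rule : Type := N -> profile -> bool.

Definition payment_rule : Type := N -> profile -> R.

(* Utility of bidder i, whose true value is v, when theta is reported. *)
Definition utility (f : allocation_rule) (p : payment_rule)
    (i : N) (v : R) (theta : profile) : R :=
  (f i theta)%:R * v - p i theta.

(* The true type t of bidder i is private, hence quantified after the payment
   rule is fixed; otherwise p could charge winners exactly their true value,
   and every allocation rule would be implementable.  The instances with
   invited t = r i are those where the whole of r i is the true neighbor set,
   in which case the side condition holds for every report. *)
Definition strategyproof (f : allocation_rule) (p : payment_rule) : Prop :=
  forall (theta : profile) (i : N) (t : type_space i),
    invited (theta i) \subset invited t ->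
    utility f p i (value t) theta <=
      utility f p i (value t) (deviate theta t).

Definition network_implementable (f : allocation_rule) : Prop :=
  exists p : payment_rule, strategyproof f p.

(* The invitation-depressed order: t1 dominates t2. *)
Definition id_ge (i : N) (t1 t2 : type_space i) : Prop :=
  value t2 <= value t1 /\ invited t1 \subset invited t2.

Definition id_mon (f : allocation_rule) : Prop :=
  forall (i : N) (theta : profile) (t t' : type_space i),
    id_ge t' t -> f i (deviate theta t) -> f i (deviate theta t').

(* Finiteness of the critical values: a bidder who wins with some report
   against theta_{-i} also wins, at some value, when she invites all of r i.
   This cannot be dropped: with unbounded values and real payments, the ID-MON
   rule under which a bidder with r i <> set0 wins iff she invites nobody is not
   network-implementable, because no constant utility from truthful inviting
   compensates the gain v - p from hiding the invitations for all v. *)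
Definition finite_critical_values (f : allocation_rule) : Prop :=
  forall (i : N) (theta : profile), f i theta ->
    exists t : type_space i, invited t = r i /\ f i (deviate theta t).

End NetworkAuction.

(* Main.v *)
(** Fix [theta_{-i}] and let [c S] be the infimum of the values at which bidder
    [i] wins when inviting [S].  ID-MON makes [c] monotone in [S].  Charge
    winners nothing and pay a loser inviting [S] the amount [c S]: truthful
    bidding then yields [max v (c S)], which is largest when [S] is the whole
    neighbor set. *)

Require Import Defs.
From mathcomp Require Import all_boot all_order all_algebra.
From mathcomp Require Import reals.
From mathcomp Require Import boolp classical_sets.

Set Implicit Arguments.
Unset Strict Implicit.
Unset Printing Implicit Defensive.

Import Order.TTheory GRing.Theory Num.Theory.
Local Open Scope ring_scope.
Local Open Scope classical_set_scope.

Section CriticalValues.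
Variables (R : realType) (N : finType) (r : N -> {set N}).
Variable f : allocation_rule R r.
Implicit Types (theta : profile R r) (i : N) (S T : {set N}).

Lemma deviate_id theta i : deviate theta (theta i) = theta.
Proof.
apply: functional_extensionality_dep => j; rewrite /deviate.
by have [->|ij] := eqVneq j i; [rewrite dfwith_in | rewrite dfwith_out // eq_sym].
Qed.

Lemma deviate_deviate theta i (t t' : type_space R r i) :
  deviate (deviate theta t) t' = deviate theta t'.
Proof.
apply: functional_extensionality_dep => j; rewrite /deviate.
have [->|ij] := eqVneq j i; first by rewrite !dfwith_in.
by rewrite !dfwith_out // eq_sym.
Qed.

Definition winning_values theta i S : set R :=
  [set v | exists t : type_space R r i,
     [/\ value t = v, invited t = S & f i (deviate theta t)]].

(* [inf set0 = 0]; by [winning_values_nonempty] this junk value only occurs when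
   the bidder loses with every report. *)
Definition critical_value theta i S : R := inf (winning_values theta i S).

Definition loser_compensation : payment_rule R r := fun i theta =>
  if f i theta then 0 else - critical_value theta i (invited (theta i)).

(** The entry of bidder [i] is overwritten by the inner [deviate] anyway. Hence her own report
    affects her payment only through the outcome and the set she invites. *)
Lemma winning_values_deviate theta i (t : type_space R r i) S :
  winning_values (deviate theta t) i S = winning_values theta i S.
Proof.
by apply/seteqP; split=> v [t' [vt' it' ft']]; exists t'; split=> //;
  move: ft'; rewrite deviate_deviate.
Qed.

Lemma winning_values_ge0 theta i S : lbound (winning_values theta i S) 0.
Proof. by move=> _ [t [<- _ _]]; case/andP: (valP t). Qed.

Lemma critical_value_le theta i S v :
  winning_values theta i S v -> critical_value theta i S <= v.
Proof. by apply: ge_inf; exists 0; apply: winning_values_ge0. Qed.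

Lemma utility_loser_compensation theta i v :
  utility f loser_compensation i v theta =
  if f i theta then v else critical_value theta i (invited (theta i)).
Proof.
rewrite /utility /loser_compensation.
by case: (f i theta); rewrite ?mul1r ?subr0 // mul0r sub0r opprK.
Qed.

Hypothesis f_mon : id_mon f.

(** Keeping the value and shrinking the invitations moves up in [id_ge], so ID-MON preserves the
    win. *)
Lemma winning_values_antitone theta i S T :
  S \subset T -> winning_values theta i T `<=` winning_values theta i S.
Proof.
move=> ST v [t [vt tT ft]].
have St : (0 <= (v, S).1) && ((v, S).2 \subset r i).
  case/andP: (valP t) => t0 tr; rewrite /= -vt t0 /=.
  by apply: (fintype.subset_trans ST); rewrite -tT.
exists (exist _ (v, S) St); split=> //.
by apply: f_mon ft; split; rewrite /value /= -?vt // /invited /= -/(invited t) tT.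
Qed.

Hypothesis f_fin : finite_critical_values f.

(** [f_fin] turns a win with any invitations into one with all of [r i], which antitonicity carries
    down to [T]. *)
Lemma winning_values_nonempty theta i S T :
  T \subset r i ->
  winning_values theta i S !=set0 -> winning_values theta i T !=set0.
Proof.
move=> Tr [v [t [_ _ /f_fin[t' [t'r]]]]]; rewrite deviate_deviate => ft'.
by exists (value t'); apply: (winning_values_antitone Tr); exists t'.
Qed.

Lemma critical_value_homo theta i S T :
  S \subset T -> T \subset r i ->
  critical_value theta i S <= critical_value theta i T.
Proof.
move=> ST Tr.
(* If no value wins with [T], then none wins with [S], and both infima take the same default
   value. *)
have [T0|/set0P Tn0] := eqVneq (winning_values theta i T) set0.
  have [S0|/set0P Sn0] := eqVneq (winning_values theta i S) set0.
    by rewrite /critical_value S0 T0.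
  by have [v] := winning_values_nonempty Tr Sn0; rewrite T0.
apply: lb_le_inf => // v Tv; apply: critical_value_le.
exact: (winning_values_antitone ST).
Qed.

(** A winning value below [value t] with the same invitations would make [t] win by ID-MON.
    Nonemptiness excludes the default infimum 0, which could lie below [value t]. *)
Lemma loser_le_critical_value theta i (t : type_space R r i) :
  winning_values theta i (invited t) !=set0 -> ~~ f i (deviate theta t) ->
  value t <= critical_value theta i (invited t).
Proof.
move=> tn0 nft; apply: lb_le_inf => // _ [t' [<- it' ft']].
rewrite leNgt; apply: contra nft => /ltW vt'.
by apply: f_mon ft'; split; rewrite ?it'.
Qed.

Lemma strategyproof_loser_compensation : strategyproof f loser_compensation.
Proof.
move=> theta i t it; rewrite !utility_loser_compensation.
have -> : deviate theta t i = t by rewrite /deviate dfwith_in.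
rewrite {2}/critical_value winning_values_deviate -/(critical_value _ _ _).
have tr : invited t \subset r i by case/andP: (valP t).
(* If both reports win, both utilities are [value t]. The remaining cases are: only [theta i] wins,
   only [t] wins, both lose. *)
case: ifPn => ftheta; case: ifPn => // ft.
- apply: loser_le_critical_value => //.
  apply: (winning_values_nonempty (S := invited (theta i)) tr).
  by exists (value (theta i)), (theta i); rewrite deviate_id.
- by apply: critical_value_le; apply: (winning_values_antitone it); exists t.
- exact: critical_value_homo.
Qed.

End CriticalValues.

Theorem theorem4p1 (R : realType) (N : finType) (r : N -> {set N})
    (f : allocation_rule R r) :
  id_mon f -> finite_critical_values f -> network_implementable f.
Proof.
move=> f_mon f_fin; exists (loser_compensation f).
exact: strategyproof_loser_compensation.
Qed.
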